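(* There exist positive reals $\gamma_k(\eta,\vartheta,d,n)$, defined for all positive integers $d,n$ with $n\geqslant 4d$, all $0<\eta,\vartheta\leqslant1$ and all $k\in\{1,\dots,\ell\}$ where $\ell\coloneqq\binom{\lfloor n/2\rfloor}{d}$, such that $\gamma_k(\eta,\vartheta,d,n)$ tends to zero as $n$ tends to infinity and $\eta,\vartheta$ tend to zero, and with the following property. Let $d,n$ be positive integers with $n\geqslant 4d$, let $0<\eta,\vartheta\leqslant1$, let $\boldsymbol{\gamma}=(\gamma_k(\eta,\vartheta,d,n))_{k=1}^{\ell}$, let $\mathcal{X}$ be a finite set, let $\mathcal{S}$ be a nonempty subset of $\mathcal{X}$, and let $\boldsymbol{X}$ be an $\mathcal{X}$-valued, $\eta$-spreadable, $d$-dimensional random array on $[n]$. If $\boldsymbol{X}$ is $(\vartheta,\mathcal{S})$-box independent, then $\boldsymbol{X}$ is $(\boldsymbol{\gamma},\mathcal{S})$-independent.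
   Context: $[n]=\{1,\dots,n\}$, $\binom{I}{d}$ is the set of $d$-element subsets of $I$. A $d$-dimensional random array on $[n]$ is a process $\boldsymbol{X}=\langle X_s:s\in\binom{[n]}{d}\rangle$; $\boldsymbol{X}_J=\langle X_s:s\in\binom{J}{d}\rangle$. $\boldsymbol{X}$ is $\eta$-spreadable if for all $J,K\subseteq[n]$ with $|J|=|K|\geqslant d$ the laws of $\boldsymbol{X}_J,\boldsymbol{X}_K$ (identified via the increasing bijection $J\to K$) are at total variation distance at most $\eta$. A $d$-dimensional box of $[n]$ is a set $\{s\in\binom{[n]}{d}:|s\cap H_i|=1\ \forall i\in[d]\}$ where $H_1,\dots,H_d$ are 2-element subsets of $[n]$ with $\max(H_i)<\min(H_{i+1})$. $\boldsymbol{X}$ is $(\vartheta,\mathcal{S})$-box independent if for every $d$-dimensional box $B$ of $[n]$ and every $a\in\mathcal{S}$, $\mathbb{P}(\bigcap_{s\in B}[X_s=a])\leqslant\prod_{s\in B}\mathbb{P}([X_s=a])+\vartheta$. For $\boldsymbol{\gamma}=(\gamma_k)_{k=1}^\ell$, $\boldsymbol{X}$ is $(\boldsymbol{\gamma},\mathcal{S})$-independent if for every nonempty $\mathcal{F}\subseteq\binom{[n]}{d}$ with $|\bigcup\mathcal{F}|\leqslant n/2$ and every family $(a_s)_{s\in\mathcal{F}}$ of elements of $\mathcal{S}$, $|\mathbb{P}(\bigcap_{s\in\mathcal{F}}[X_s=a_s])-\prod_{s\in\mathcal{F}}\mathbb{P}([X_s=a_s])|\leqslant\gamma_{|\mathcal{F}|}$.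 *)

(* Defs.v *)
(* finite random arrays are represented by their joint law,
   a probability distribution on the finite set of configurations. *)
From HB Require Import structures.
From mathcomp Require Import all_boot all_order all_algebra.
From mathcomp Require Import reals.
Set Implicit Arguments. Unset Strict Implicit. Unset Printing Implicit Defensive.
Import Order.TTheory GRing.Theory Num.Theory.
Local Open Scope ring_scope.

(* [n] is modelled by 'I_n = {0,...,n-1} (order-preserving relabelling). *)

Definition dsub (n d : nat) := {s : {set 'I_n} | #|s| == d}.

Definition cfg (X : finType) (n d : nat) := {ffun dsub n d -> X}.

Section Defs.
Variable R : realType.

Definition is_distr (T : finType) (mu : T -> R) :=
  (forall x, 0 <= mu x) /\ \sum_x mu x = 1.

Definition prob (T : finType) (mu : T -> R) (E : pred T) : R :=
  \sum_(x | E x) mu x.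

Definition tvdist (T : finType) (p q : T -> R) : R :=
  2^-1 * \sum_x `|p x - q x|.

Definition pushforward (T U : finType) (f : T -> U) (mu : T -> R) : U -> R :=
  fun u => prob mu (fun x => f x == u).

Definition incr (n m : nat) (J : {set 'I_n}) (H : #|J| = m) : 'I_m -> 'I_n :=
  fun i => enum_val (cast_ord (esym H) i).

Lemma incr_inj n m (J : {set 'I_n}) (H : #|J| = m) : injective (incr H).
Proof.
move=> i j /enum_val_inj /(congr1 val) /= Hij; exact: val_inj.
Qed.

Lemma card_lift_dsub n m d (f : 'I_m -> 'I_n) (fi : injective f) (t : dsub m d) :
  #|f @: val t| == d.
Proof. by rewrite card_imset //; exact: (valP t). Qed.

Definition lift_dsub n m d (f : 'I_m -> 'I_n) (fi : injective f)
  (t : dsub m d) : dsub n d := exist _ (f @: val t) (card_lift_dsub fi t).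

Definition restr (X : finType) n m d (J : {set 'I_n}) (H : #|J| = m)
  (c : cfg X n d) : cfg X m d :=
  [ffun t => c (lift_dsub (@incr_inj n m J H) t)].

Definition spreadable (X : finType) n d (eta : R) (mu : cfg X n d -> R) :=
  forall (J K : {set 'I_n}) (HJK : #|J| = #|K|), (d <= #|J|)%N ->
    tvdist (pushforward (@restr X n #|J| d J erefl) mu)
           (pushforward (@restr X n #|J| d K (esym HJK)) mu) <= eta.

Definition is_box_seq n d (H : 'I_d -> {set 'I_n}) :=
  (forall i, #|H i| = 2%N) /\
  (forall i j : 'I_d, val j = (val i).+1 ->
     forall x y, x \in H i -> y \in H j -> (x < y)%N).

Definition box n d (H : 'I_d -> {set 'I_n}) : {set dsub n d} :=
  [set s : dsub n d | [forall i, #|val s :&: H i| == 1%N]].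

Definition box_independent (X : finType) n d (theta : R) (S : {set X})
  (mu : cfg X n d -> R) :=
  forall H : 'I_d -> {set 'I_n}, is_box_seq H ->
  forall a, a \in S ->
    prob mu (fun c => [forall s in box H, c s == a])
      <= \prod_(s in box H) prob mu (fun c => c s == a) + theta.

Definition independent (X : finType) n d (gamma : nat -> R) (S : {set X})
  (mu : cfg X n d -> R) :=
  forall F : {set dsub n d}, F != set0 ->
    (2 * #|\bigcup_(s in F) val s| <= n)%N ->
  forall a : dsub n d -> X, (forall s, s \in F -> a s \in S) ->
    `| prob mu (fun c => [forall s in F, c s == a s])
       - \prod_(s in F) prob mu (fun c => c s == a s) | <= gamma #|F|.

End Defs.

(* Main.v *)
(**
  Call a finite family of coloured edges good if its joint colour probability is close to
  the product of its single-colour probabilities.  Spreadability lets a vertex j slide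
  freely inside a long block, so one can average over its positions.  If the star W of j
  and its doubling W(j) W(j') are both good, then the block average of 1_W has mean c and
  second moment c^2 up to small errors, hence is nearly constant in L^2, and W becomes
  independent of every family Z avoiding j.

  Consequently a family whose edges share a set C of vertices, some of which are doubled,
  is good as soon as the same holds for every C of size one larger: split off the star of a
  vertex outside C and induct on the number of edges.  Doubling repeats colours, so for
  |C| = d the family is a (partial) box with a single colour a.  Doubling all vertices
  gives a full box, whose probability is at most p_a^(2^d) up to theta; on the other hand
  each doubling at least squares the probability by Jensen's inequality, so every
  intermediate box has the expected probability.  This is the only place where box
  independence is used.

  For gamma one takes the supremum of all possible deviations, plus eta.
*)
Require Import Defs.
From HB Require Import structures.
From mathcomp Require Import all_boot all_order all_algebra.
From mathcomp Require Import reals.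
From mathcomp Require Import zify ring lra.
Set Implicit Arguments. Unset Strict Implicit. Unset Printing Implicit Defensive.
Import Order.TTheory GRing.Theory Num.Theory.
Local Open Scope ring_scope.

(** * Averages over a block *)

Section FiniteProbability.
Context {R : realType} {T : finType} (mu : T -> R).
Hypothesis mu_distr : is_distr mu.

Definition expect (f : T -> R) : R := \sum_x mu x * f x.

Lemma prob_expect (E : pred T) : prob mu E = expect (fun x => (E x)%:R).
Proof.
rewrite /prob /expect big_mkcond; apply: eq_bigr => x _.
by case: (E x); rewrite ?mulr1 ?mulr0.
Qed.

Lemma expect_le f g : (forall x, f x <= g x) -> expect f <= expect g.
Proof.
by move=> fg; apply: ler_sum => x _; rewrite ler_wpM2l //; case: mu_distr.
Qed.

Lemma expectD f g : expect (fun x => f x + g x) = expect f + expect g.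
Proof. by rewrite /expect -big_split; apply: eq_bigr => x _; rewrite mulrDr. Qed.

Lemma expectZ k f : expect (fun x => k * f x) = k * expect f.
Proof. by rewrite /expect mulr_sumr; apply: eq_bigr => x _; rewrite mulrCA. Qed.

Lemma expect_cst k : expect (fun=> k) = k.
Proof. by rewrite /expect -mulr_suml; case: mu_distr => _ ->; rewrite mul1r. Qed.

Lemma expect_sum (I : finType) (f : I -> T -> R) :
  expect (fun x => \sum_i f i x) = \sum_i expect (f i).
Proof.
rewrite /expect exchange_big; apply: eq_bigr => x _; exact: mulr_sumr.
Qed.

Lemma expect_sqr_ge f : expect f ^+ 2 <= expect (fun x => f x ^+ 2).
Proof.
set t := expect f.
have: 0 <= expect (fun x => (f x ^+ 2 + (- 2 * t) * f x) + t ^+ 2).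
  rewrite -(expect_cst 0); apply: expect_le => x.
  have -> : f x ^+ 2 + - 2 * t * f x + t ^+ 2 = (f x - t) ^+ 2 by ring.
  exact: sqr_ge0.
rewrite 2!expectD expectZ expect_cst -/t; lra.
Qed.

Lemma prob_ge0 (E : pred T) : 0 <= prob mu E.
Proof. by apply: sumr_ge0 => x _; case: mu_distr. Qed.

Lemma prob_le (E F : pred T) : (forall x, E x -> F x) -> prob mu E <= prob mu F.
Proof.
move=> EF; rewrite !prob_expect; apply: expect_le => x.
by case: (boolP (E x)) => [/EF ->|_] //; rewrite ler0n.
Qed.

Lemma eq_prob (E F : pred T) : E =1 F -> prob mu E = prob mu F.
Proof. by move=> EF; apply: eq_bigl. Qed.

Lemma prob_le1 (E : pred T) : prob mu E <= 1.
Proof.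
rewrite -[leRHS](expect_cst 1) prob_expect; apply: expect_le => x.
by rewrite lern1 leq_b1.
Qed.

Section BlockAverage.
Variables (N : nat) (Y : 'I_N -> pred T).
Hypothesis N_gt0 : (0 < N)%N.

Definition block_mean (x : T) : R := N%:R^-1 * \sum_r (Y r x)%:R.

Lemma block_mean_expect (Z : pred T) :
  expect (fun x => block_mean x * (Z x)%:R) =
  N%:R^-1 * \sum_r prob mu (fun x => Y r x && Z x).
Proof.
transitivity (expect (fun x => N%:R^-1 * \sum_r (Y r x && Z x)%:R)).
  apply: eq_bigr => x _; congr (_ * _).
  rewrite /block_mean -mulrA mulr_suml; congr (_ * _).
  by apply: eq_bigr => r _; rewrite -natrM mulnb.
rewrite expectZ expect_sum; congr (_ * _).
by apply: eq_bigr => r _; rewrite prob_expect.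
Qed.

(** Expand the square into [N ^ 2] pairs. Diagonal pairs contribute at most 1 each, hence [1/N]
    after normalisation; every other pair contributes at most [b]. *)
Lemma block_mean_sqr_le (b : R) :
  (forall r s : 'I_N, (r < s)%N -> prob mu (fun x => Y r x && Y s x) <= b) ->
  0 <= b -> expect (fun x => block_mean x ^+ 2) <= N%:R^-1 + b.
Proof.
move=> Yb b_ge0.
have N0 : 0 < N%:R :> R by rewrite ltr0n.
have offdiag r s : r != s -> prob mu (fun x => Y r x && Y s x) <= b.
  rewrite neq_ltn => /orP [|] rs; first exact: Yb.
  by rewrite (@eq_prob _ (fun x => Y s x && Y r x)) ?Yb // => x; rewrite andbC.
have -> : expect (fun x => block_mean x ^+ 2) =
    N%:R^-1 ^+ 2 * \sum_r \sum_s prob mu (fun x => Y r x && Y s x).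
  transitivity (expect (fun x => N%:R^-1 ^+ 2 *
      \sum_r \sum_s (Y r x && Y s x)%:R)).
    apply: eq_bigr => x _; congr (_ * _).
    rewrite /block_mean exprMn; congr (_ * _).
    rewrite expr2 mulr_suml; apply: eq_bigr => r _.
    by rewrite mulr_sumr; apply: eq_bigr => s _; rewrite -natrM mulnb.
  rewrite expectZ expect_sum; congr (_ * _); apply: eq_bigr => r _.
  by rewrite expect_sum; apply: eq_bigr => s _; rewrite prob_expect.
have row (r : 'I_N) : \sum_s prob mu (fun x => Y r x && Y s x) <= 1 + N%:R * b.
  rewrite (bigD1 r) //=; apply: lerD; first exact: prob_le1.
  apply: (@le_trans _ _ (\sum_(s < N | s != r) b)).
    by apply: ler_sum => s sr; apply: offdiag; rewrite eq_sym.
  rewrite sumr_const mulr_natl; apply: (ler_wpMn2l b_ge0).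
  by rewrite (leq_trans (max_card _)) ?card_ord.
apply: (@le_trans _ _ (N%:R^-1 ^+ 2 * (N%:R * (1 + N%:R * b)))).
  rewrite ler_wpM2l ?sqr_ge0 //.
  apply: (@le_trans _ _ (\sum_(r < N) (1 + N%:R * b))).
    by apply: ler_sum => r _; exact: row.
  by rewrite sumr_const card_ord [leRHS]mulr_natl.
have -> : N%:R^-1 ^+ 2 * (N%:R * (1 + N%:R * b)) = N%:R^-1 + b :> R.
  by field; rewrite gt_eqF.
by [].
Qed.

Lemma expect_block_mean : expect block_mean = N%:R^-1 * \sum_r prob mu (Y r).
Proof.
rewrite /block_mean expectZ expect_sum; congr (_ * _).
by apply: eq_bigr => r _; rewrite prob_expect.
Qed.

Lemma mean_ge (u : 'I_N -> R) a : (forall r, a <= u r) -> a <= N%:R^-1 * \sum_r u r.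
Proof.
move=> au; have N0 : 0 < N%:R :> R by rewrite ltr0n.
rewrite ler_pdivlMl // mulr_natl -[in leLHS](card_ord N) -sumr_const.
by apply: ler_sum.
Qed.

Lemma mean_le (u : 'I_N -> R) a : (forall r, u r <= a) -> N%:R^-1 * \sum_r u r <= a.
Proof.
move=> au; rewrite -lerN2 -mulrN -sumrN.
by apply: mean_ge => r; rewrite lerN2.
Qed.

(* The block mean is within a small L2-distance of c, so that it may be replaced by c
   in the presence of any further event Z. *)
Lemma block_mean_decouple (Z : pred T) (b c e : R) :
  (forall r s : 'I_N, (r < s)%N -> prob mu (fun x => Y r x && Y s x) <= b) ->
  0 <= b -> 0 <= c -> (forall r, c - e <= prob mu (Y r)) ->
  (N%:R^-1 * \sum_r prob mu (fun x => Y r x && Z x) - c * prob mu Z) ^+ 2 <=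
  N%:R^-1 + b - c ^+ 2 + 2 * c * e.
Proof.
move=> Yb b_ge0 c_ge0 Yc; rewrite -block_mean_expect prob_expect.
have -> : expect (fun x => block_mean x * (Z x)%:R) - c * expect (fun x => (Z x)%:R)
  = expect (fun x => (block_mean x - c) * (Z x)%:R).
  by rewrite -mulNr -expectZ -expectD; apply: eq_bigr => x _; rewrite mulrBl mulNr.
apply: le_trans (expect_sqr_ge _) _.
(* Dropping the indicator of [Z] leaves the mean square of [block_mean - c]. As [c] is nonnegative,
   it is bounded through a lower bound on the first moment of [block_mean] and an upper bound on the
   second. *)
apply: (@le_trans _ _
  (expect (fun x => (block_mean x ^+ 2 + (- 2 * c) * block_mean x) + c ^+ 2))).
  apply: expect_le => x; case: (Z x); rewrite ?mulr1 ?mulr0; first by lra.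
  have := sqr_ge0 (block_mean x - c); lra.
rewrite 2!expectD expectZ expect_cst expect_block_mean.
have := block_mean_sqr_le Yb b_ge0.
have := mean_ge Yc.
set v := _ * \sum_r _; set w := expect _; move=> cv wb.
have := ler_wpM2l c_ge0 cv; nra.
Qed.

Lemma mean_sqr_le (b : R) :
  (forall r s : 'I_N, (r < s)%N -> prob mu (fun x => Y r x && Y s x) <= b) ->
  0 <= b -> (N%:R^-1 * \sum_r prob mu (Y r)) ^+ 2 <= N%:R^-1 + b.
Proof.
move=> Yb b_ge0; rewrite -expect_block_mean.
exact: le_trans (expect_sqr_ge _) (block_mean_sqr_le Yb b_ge0).
Qed.

End BlockAverage.
End FiniteProbability.

(** [2 * tvdist p q] is the full l1 distance, which dominates its part over [E]. This is the source
    of the factor 2 in the spreadability errors below. *)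
Lemma prob_diff_le (R : realType) (T : finType) (p q : T -> R) (E : pred T) :
  `|prob p E - prob q E| <= 2 * tvdist p q.
Proof.
rewrite /tvdist mulrA mulfV ?mul1r ?pnatr_eq0 // /prob -sumrB.
apply: le_trans (ler_norm_sum _ _ _) _.
rewrite [leRHS](bigID E) /= lerDl; apply: sumr_ge0 => x _; exact: normr_ge0.
Qed.

Lemma prob_pushforward (R : realType) (T U : finType) (f : T -> U) (mu : T -> R)
  (E : pred U) : prob (pushforward f mu) E = prob mu (fun x => E (f x)).
Proof.
rewrite /prob /pushforward /prob [RHS](partition_big f E) //=.
apply: eq_bigr => u Eu; apply: eq_bigl => x.
by case: eqP => [->|]; rewrite ?Eu ?andbF.
Qed.

(** Replace the factors one at a time: all other factors lie in [0,1], so each replacement costs at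
    most [e]. *)
Lemma norm_prod_diff_le (R : realType) (I : Type) (s : seq I) (P : pred I)
  (x y : I -> R) (e : R) :
  (forall i, P i -> 0 <= x i <= 1) -> (forall i, P i -> 0 <= y i <= 1) ->
  (forall i, P i -> `|x i - y i| <= e) ->
  `|\prod_(i <- s | P i) x i - \prod_(i <- s | P i) y i| <= (count P s)%:R * e.
Proof.
move=> x01 y01 xye; elim: s => [|i s IH]; first by rewrite !big_nil subrr normr0 mul0r.
rewrite !big_cons /=; case Pi : (P i); last by rewrite add0n.
have prod01 (z : I -> R) : (forall i, P i -> 0 <= z i <= 1) ->
    0 <= \prod_(j <- s | P j) z j <= 1.
  move=> z01; elim/big_ind: _ => [|a b /andP[a0 a1] /andP[b0 b1]|//].
  - by rewrite ler01 lexx.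
  - by rewrite mulr_ge0 //= mulr_ile1.
have /andP [xi0 xi1] := x01 _ Pi.
have /andP [py0 py1] := prod01 _ y01.
set px := \prod_(_ <- _ | _) x _ in IH *; set py := \prod_(_ <- _ | _) y _ in IH py0 py1 *.
have -> : x i * px - y i * py = x i * (px - py) + (x i - y i) * py by ring.
apply: le_trans (ler_normD _ _) _.
rewrite -[(true + _)%N]/(count P s).+1 -natr1 [leRHS]mulrDl mul1r; apply: lerD; rewrite normrM.
- by rewrite (ger0_norm xi0); apply: le_trans IH; rewrite ler_piMl.
- rewrite (ger0_norm py0); apply: le_trans (xye _ Pi).
  by rewrite ler_piMr.
Qed.

(** * Patterns and spreadability *)

Section Patterns.
Context {X : finType}.

(* None when the entries of e do not form a d-element subset of [n]. *)
Definition value n d (c : cfg X n d) (e : seq nat) : option X :=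
  omap c (insub [set i : 'I_n | val i \in e]).

(** A pattern [F] is a list of coloured edges on abstract vertices, which are natural numbers; [phi]
    places it in [n]. Sliding or doubling a vertex then becomes a change of [phi] or a
    relabelling. *)
Definition occurs n d (c : cfg X n d) (phi : nat -> nat) (F : seq (seq nat * X)) :=
  all (fun e => value c (map phi e.1) == Some e.2) F.

Lemma value_dsub n d (c : cfg X n d) (s : dsub n d) e :
  (forall i : 'I_n, (i \in val s) = (val i \in e)) -> value c e = Some (c s).
Proof.
move=> se; rewrite /value.
have -> : [set i : 'I_n | val i \in e] = val s by apply/setP => i; rewrite inE se.
by rewrite valK.
Qed.

Lemma value_restr n m d (J : {set 'I_n}) (H : #|J| = m) (phi : nat -> nat)
  (c : cfg X n d) e :
  (forall i : 'I_m, val (incr H i) = phi i) -> {in e, forall x, (x < m)%N} ->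
  value (restr H c) e = value c (map phi e).
Proof.
move=> Hphi em.
have imE : [set i : 'I_n | val i \in map phi e] =
           incr H @: [set i : 'I_m | val i \in e].
  apply/setP => i; rewrite inE; apply/mapP/imsetP => [[x xe ix]|[j]].
    exists (Ordinal (em _ xe)); rewrite ?inE //.
    by apply: val_inj; rewrite Hphi.
  by rewrite inE => je ->; exists (val j); rewrite ?Hphi.
rewrite /value imE; case: insubP => [t _ tE|card_e] /=.
  rewrite ffunE; set s := lift_dsub _ _.
  by have -> : incr H @: [set i : 'I_m | val i \in e] = val s; rewrite ?valK //= -tE.
(* An injective image keeps the cardinality, so an edge of the wrong size gives [None] on both
   sides. *)
by rewrite insubN // card_imset //; exact: incr_inj.
Qed.

Lemma occurs_restr n m d (J : {set 'I_n}) (H : #|J| = m) (phi : nat -> nat)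
  (c : cfg X n d) (F : seq (seq nat * X)) :
  (forall i : 'I_m, val (incr H i) = phi i) ->
  {in F, forall e, {in e.1, forall x, (x < m)%N}} ->
  occurs (restr H c) id F = occurs c phi F.
Proof.
move=> Hphi Fm; apply: eq_in_all => e eF.
by rewrite map_id (value_restr c Hphi) //; exact: Fm.
Qed.

Lemma occurs_cat n d (c : cfg X n d) phi F G :
  occurs c phi (F ++ G) = occurs c phi F && occurs c phi G.
Proof. exact: all_cat. Qed.

Lemma occurs_comp n d (c : cfg X n d) phi psi (F : seq (seq nat * X)) :
  occurs c phi [seq (map psi e.1, e.2) | e <- F] = occurs c (phi \o psi) F.
Proof. by rewrite /occurs all_map; apply: eq_all => e /=; rewrite map_comp. Qed.

Lemma eq_in_occurs n d (c : cfg X n d) phi psi (F : seq (seq nat * X)) :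
  {in F, forall e, {in e.1, phi =1 psi}} -> occurs c phi F = occurs c psi F.
Proof.
move=> Fe; apply: eq_in_all => e eF; congr (value c _ == _).
exact/eq_in_map/Fe.
Qed.

End Patterns.

(** * Increasing placements and the sets they occupy *)

Lemma sorted_enum_ord n (A : {set 'I_n}) : sorted ltn (map val (enum A)).
Proof.
have -> : enum A = filter (mem A) (enum 'I_n) by rewrite enumT.
rewrite sorted_map; apply: sorted_filter; first by move=> x y z; exact: ltn_trans.
by rewrite -(sorted_map (f := val)) val_enum_ord iota_ltn_sorted.
Qed.

Definition mono_embed m n (phi : nat -> nat) :=
  (forall x y, x < y < m -> phi x < phi y)%N /\ (forall x, x < m -> phi x < n)%N.

Section Embedding.
Variables (m n : nat) (phi : nat -> nat).
Hypothesis phi_embed : mono_embed m n phi.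

Definition embed_set : {set 'I_n} := [set i | val i \in map phi (iota 0 m)].

Lemma embed_enum : map val (enum embed_set) = map phi (iota 0 m).
Proof.
apply: (@irr_sorted_eq _ ltn ltn_trans ltnn).
- exact: sorted_enum_ord.
- apply/(sortedP 0%N); rewrite size_map size_iota => i im.
  rewrite !(nth_map 0%N) ?size_iota ?nth_iota //; try lia.
  by apply: phi_embed.1; lia.
- move=> x; apply/mapP/mapP => [[i]|[y]].
    by rewrite mem_enum inE => /mapP[y ym ->] ->; exists y.
  rewrite mem_iota => ym ->.
  have yn : (phi y < n)%N by apply: phi_embed.2.
  exists (Ordinal yn) => //; rewrite mem_enum inE /=.
  by apply/mapP; exists y; rewrite ?mem_iota.
Qed.

Lemma card_embed_set : #|embed_set| = m.
Proof. by rewrite cardE -(size_map val) embed_enum size_map size_iota. Qed.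

(** An increasing map is the increasing enumeration of its image; hence [spreadable], which speaks
    of sets, applies to placements given by maps. *)
Lemma incr_embed k (H : #|embed_set| = k) (i : 'I_k) : val (incr H i) = phi i.
Proof.
have km : k = m by rewrite -H card_embed_set.
have im : (i < m)%N by rewrite -km.
have en : (size (enum embed_set) = m) by rewrite -cardE card_embed_set.
(* ['I_n] has no canonical inhabitant, so the enumerated value itself serves as the default of
   [nth]. *)
rewrite /incr (enum_val_nth (enum_val (cast_ord (esym H) i))) /=.
rewrite -(nth_map _ 0%N) ?en // embed_enum.
by rewrite (nth_map 0%N) ?size_iota // nth_iota.
Qed.

End Embedding.

(** * Frequencies of patterns under spreadability *)

Section Frequency.
Context {R : realType} {X : finType} {n d : nat} (mu : cfg X n d -> R).

Definition freq (phi : nat -> nat) (F : seq (seq nat * X)) : R :=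
  prob mu (fun c => occurs c phi F).

(** The first [d] points form a reference edge; under spreadability every edge has nearly the same
    colour law. *)
Definition rate (a : X) : R := prob mu (fun c => value c (iota 0 d) == Some a).

Definition weight (F : seq (seq nat * X)) : R := \prod_(e <- F) rate e.2.

(** Both frequencies are probabilities of the same event, read off the restrictions of the array to
    two sets of size [m]. *)
Lemma freq_spread eta m phi psi (F : seq (seq nat * X)) : spreadable eta mu ->
  mono_embed m n phi -> mono_embed m n psi -> (d <= m)%N ->
  {in F, forall e, {in e.1, forall x, (x < m)%N}} ->
  `|freq phi F - freq psi F| <= 2 * eta.
Proof.
move=> mu_spr phiP psiP dm Fm.
set J := embed_set m n phi; set K := embed_set m n psi.
have cJ : #|J| = m by exact: card_embed_set.
have HJK : #|J| = #|K| by rewrite cJ card_embed_set.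
have FJ : {in F, forall e, {in e.1, forall x, (x < #|J|)%N}} by rewrite cJ.
have := mu_spr J K HJK; rewrite {1}cJ => /(_ dm) tv.
have -> : freq phi F =
  prob (pushforward (@restr X n #|J| d J erefl) mu) (fun c => occurs c id F).
  rewrite prob_pushforward; apply: eq_prob => c.
  by rewrite (occurs_restr c (incr_embed phiP erefl) FJ).
have -> : freq psi F =
  prob (pushforward (@restr X n #|J| d K (esym HJK)) mu) (fun c => occurs c id F).
  rewrite prob_pushforward; apply: eq_prob => c.
  by rewrite (occurs_restr c (incr_embed psiP (esym HJK)) FJ).
by apply: le_trans (prob_diff_le _ _ _) _; rewrite ler_wpM2l.
Qed.

Lemma rate_spread eta (e : seq nat) a : spreadable eta mu -> (d <= n)%N ->
  sorted ltn e -> size e = d -> {in e, forall x, (x < n)%N} ->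
  `|prob mu (fun c => value c e == Some a) - rate a| <= 2 * eta.
Proof.
move=> mu_spr dn e_sorted e_size en.
(* The list [e], read as the map [nth 0 e], places the reference edge. *)
have ->: prob mu (fun c => value c e == Some a) = freq (nth 0%N e) [:: (iota 0 d, a)].
  have eE : map (nth 0%N e) (iota 0 d) = e.
    by rewrite -[X in iota 0 X]e_size -/(mkseq (nth 0%N e) (size e)) mkseq_nth.
  by apply: eq_prob => c; rewrite /occurs /= andbT eE.
have -> : rate a = freq id [:: (iota 0 d, a)].
  by apply: eq_prob => c; rewrite /occurs /= andbT map_id.
apply: (@freq_spread _ d) => //.
- split=> [x y /andP[xy yd]|x xd].
    by apply: (sorted_ltn_nth ltn_trans) => //; rewrite inE e_size //; lia.
  by apply: en; rewrite mem_nth ?e_size.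
- by split=> [x y /andP[]|x xd] //; exact: leq_trans dn.
- by move=> _ /[!inE] /eqP -> x /=; rewrite mem_iota.
Qed.

Lemma rate_dsub eta (s : dsub n d) a : spreadable eta mu ->
  `|prob mu (fun c => c s == a) - rate a| <= 2 * eta.
Proof.
move=> mu_spr; have card_s : #|val s| = d by apply/eqP: (valP s).
have mem_s (i : 'I_n) : (i \in val s) = (val i \in map val (enum (val s))).
  by rewrite mem_map ?mem_enum //; exact: val_inj.
have -> : prob mu (fun c => c s == a) =
    prob mu (fun c => value c (map val (enum (val s))) == Some a).
  by apply: eq_prob => c; rewrite (value_dsub c mem_s).
apply: rate_spread => //.
- by rewrite -card_s -[leqRHS]card_ord max_card.
- exact: sorted_enum_ord.
- by rewrite size_map -cardE.
- by move=> _ /mapP[i _ ->]; exact: ltn_ord.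
Qed.

End Frequency.

(** * Doubling a vertex *)

Section Doubling.
Context {X : finType}.
Implicit Types (F G : seq (seq nat * X)) (P : seq nat).

Definition shift j x := if x == j then j.+1 else x.

(** Edges avoiding [j] are kept twice, so that the weight is always exactly squared; in the
    inductions below [j] lies in every edge being doubled. *)
Definition dbl j F := F ++ [seq (map (shift j) e.1, e.2) | e <- F].

Definition dbls P F := foldr dbl F P.

(** Locates the vertices present after doubling; it serves to bound them and to find the slots that
    are still free. *)
Lemma mem_dbls P F e : e \in dbls P F -> exists f, [/\ f \in F, e.2 = f.2 &
  {in e.1, forall x, x \in f.1 \/ exists2 y, y \in P & x = y.+1}].
Proof.
elim: P e => [|j P IH] e /=; first by move=> eF; exists e; split => // x; left.
rewrite mem_cat => /orP[/IH[f [fF ef fP]]|/mapP[e' /IH[f [fF ef fP]] ->]] /=.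
  exists f; split => // x /fP[|[y yP ->]]; first by left.
  by right; exists y; rewrite ?inE ?yP ?orbT.
exists f; split => // x /mapP[z /fP zP ->]; rewrite /shift; case: eqP => _.
  by right; exists j; rewrite ?inE ?eqxx.
case: zP => [|[y yP ->]]; first by left.
by right; exists y; rewrite ?inE ?yP ?orbT.
Qed.

Lemma perm_dbl j F G : perm_eq F G -> perm_eq (dbl j F) (dbl j G).
Proof. by move=> FG; apply: perm_cat => //; exact: perm_map. Qed.

Lemma perm_dbls P F G : perm_eq F G -> perm_eq (dbls P F) (dbls P G).
Proof. by move=> FG; elim: P => //= j P; exact: perm_dbl. Qed.

(** Doubling acts edge by edge, so a pattern can be split into a star and the rest before or after
    doubling. *)
Lemma perm_dbls_cat P F G : perm_eq (dbls P (F ++ G)) (dbls P F ++ dbls P G).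
Proof.
elim: P => //= j P IH; apply: perm_trans (perm_dbl j IH) _.
by rewrite /dbl map_cat perm_catACA.
Qed.

Lemma dbls_nil P : dbls P [::] = [::] :> seq (seq nat * X).
Proof. by elim: P => //= j P ->. Qed.

(* For P = e these are all the edges of a box. *)
Lemma dbls_shifts P (e : seq nat) (a : X) (b : pred nat) : uniq P ->
  {in P, forall x, ~~ odd x} ->
  {in e, forall x, ~~ odd x} ->
  (map (fun x => x + (b x && (x \in P)))%N e, a) \in dbls P [:: (e, a)].
Proof.
move=> P_uniq P_even e_even; elim: P P_uniq P_even => [|j P IH] /=.
  by move=> _ _; under eq_map => x do rewrite andbF addn0; rewrite map_id mem_seq1.
move=> /andP[jP P_uniq] P_even.
have {}IH := IH P_uniq (fun x xP => P_even x (mem_behead (s := j :: P) xP)).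
have j_even : ~~ odd j by apply: P_even; rewrite mem_head.
rewrite mem_cat; case bj : (b j); apply/orP; [right|left].
  apply/mapP; eexists; first exact: IH.
  congr pair => /=; rewrite -map_comp; apply/eq_in_map => x xe /=.
  have x_even := e_even _ xe; rewrite /shift inE.
  have [->|xj] := eqVneq x j; first by rewrite bj (negPf jP) andbF addn0 eqxx /= addn1.
  (* A vertex [x] other than [j] cannot have been moved onto [j]: its double [x + 1] is odd and [j]
     is even. *)
  rewrite /=; case: eqP => // xbj; move: xbj x_even j_even xj => <-.
  by case: (_ && _); rewrite ?addn1 ?addn0 ?eqxx //= => ->.
have -> // : map (fun x => x + (b x && (x \in j :: P)))%N e =
             map (fun x => x + (b x && (x \in P)))%N e.
apply/eq_in_map => x xe.
by rewrite inE; have [->|//] := eqVneq x j; rewrite bj.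
Qed.

End Doubling.

Section Weight.
Context {R : realType} {X : finType} {n d : nat} (mu : cfg X n d -> R).
Implicit Types (F G : seq (seq nat * X)) (P : seq nat).

Lemma weight_cat F G : weight mu (F ++ G) = weight mu F * weight mu G.
Proof. exact: big_cat. Qed.

Lemma weight_perm F G : perm_eq F G -> weight mu F = weight mu G.
Proof. by move=> FG; exact: perm_big. Qed.

Lemma weight_dbl j F : weight mu (dbl j F) = weight mu F ^+ 2.
Proof. by rewrite weight_cat /weight big_map expr2. Qed.

Lemma freq_perm phi F G : perm_eq F G -> freq mu phi F = freq mu phi G.
Proof. by move=> FG; apply: eq_prob => c; exact: perm_all. Qed.

Lemma weight_dbls_single P (e : seq nat) (a : X) :
  weight mu (dbls P [:: (e, a)]) = rate mu a ^+ (2 ^ size P).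
Proof.
elim: P => [|j P IH] /=; first by rewrite /weight big_seq1.
by rewrite weight_dbl IH -exprM mulnC -expnS.
Qed.

Hypothesis mu_distr : is_distr mu.

Lemma freq01 phi F : 0 <= freq mu phi F <= 1.
Proof. by rewrite prob_ge0 ?prob_le1. Qed.

Lemma weight01 F : 0 <= weight mu F <= 1.
Proof.
rewrite /weight; elim: F => [|e F /andP[F0 F1]]; first by rewrite big_nil ler01 lexx.
by rewrite big_cons mulr_ge0 ?mulr_ile1 // ?prob_ge0 ?prob_le1.
Qed.

End Weight.

(** * Sliding a vertex inside its block *)

Section Blocks.
Context {R : realType} {X : finType} {n d : nat} (mu : cfg X n d -> R).
Variables (delta : R) (N M : nat).
Hypotheses (mu_distr : is_distr mu) (mu_spr : spreadable delta mu).
Hypotheses (N_gt0 : (0 < N)%N) (N_large : N%:R^-1 <= delta).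
Hypotheses (MN : (M * N <= n)%N) (dM : (d <= M)%N).
Implicit Types (F G W Z : seq (seq nat * X)).

Definition bounded F := {in F, forall e, {in e.1, forall x, (x < M)%N}}.

(* Vertex x of a pattern is placed at the start of the block [Nx, Nx + N);
   [move j r] slides vertex j to offset r inside its block, and [move2 j r s]
   places both j and j + 1 in the block of j. *)
Definition move j r x := (N * x + (if x == j then r else 0))%N.

Definition move2 j r s x :=
  (if x == j then N * j + r else if x == j.+1 then N * j + s else N * x)%N.

Lemma scale_embed : mono_embed M n (muln N).
Proof. by split => [x y|x] H; nia. Qed.

Lemma move_embed j r : (r < N)%N -> mono_embed M n (move j r).
Proof.
by move=> rN; split => [x y|x]; rewrite /move; do !case: eqP => ?; nia.
Qed.

Lemma move2_embed j r s : (r < s < N)%N -> mono_embed M n (move2 j r s).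
Proof.
by move=> rN; split => [x y|x]; rewrite /move2; do !case: eqP => ?; nia.
Qed.

(** As the slot [j + 1] is free, it can carry the second copy of [j], and the two slid copies of [W]
    become one placement of the doubled pattern. *)
Lemma occurs_move2 j r s W (c : cfg X n d) : {in W, forall e, j.+1 \notin e.1} ->
  occurs c (move j r) W && occurs c (move j s) W =
  occurs c (move2 j r s) (dbl j W).
Proof.
move=> Wj; rewrite occurs_cat occurs_comp; congr andb; apply: eq_in_occurs => e eW x xe.
- have xj : x != j.+1 by apply: contraNneq (Wj e eW) => <-.
  by rewrite /move /move2 (negPf xj); case: eqP => [->|]; rewrite ?addn0.
- have xj : x != j.+1 by apply: contraNneq (Wj e eW) => <-.
  rewrite /move /move2 /shift /=; case: (eqVneq x j) => [->|xj'].
    by rewrite eqxx; case: eqP => //; lia.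
  by rewrite (negPf xj') (negPf xj) addn0.
Qed.

Lemma bounded_dbl j F : bounded F -> (j.+1 < M)%N -> bounded (dbl j F).
Proof.
move=> FM jM e; rewrite mem_cat => /orP[/FM //|/mapP[f fF ->] x /= /mapP[y yf ->]].
by rewrite /shift; case: eqP => // _; exact: FM fF _ yf.
Qed.

Lemma pair_freq_le j W b (r s : 'I_N) :
  bounded W -> (j.+1 < M)%N -> {in W, forall e, j.+1 \notin e.1} ->
  freq mu (muln N) (dbl j W) <= b -> (r < s)%N ->
  prob mu (fun c => occurs c (move j r) W && occurs c (move j s) W) <= b + 2 * delta.
Proof.
move=> WM jM Wj Wb rs.
rewrite (eq_prob _ (fun c => occurs_move2 r s c Wj)).
have rsN : (r < s < N)%N by rewrite rs ltn_ord.
have := freq_spread (F := dbl j W) mu_spr (move2_embed j rsN) scale_embed dM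
  (bounded_dbl WM jM).
by move: Wb; rewrite /freq ler_norml => Wb /andP[_]; lra.
Qed.

(** Jensen's inequality for the block mean [m]. The diagonal and the pairs cost [3 * delta];
    replacing the frequency of [W] by [m], which is at most [2 * delta] smaller, costs [4 * delta]
    in the squares. *)
Lemma freq_dbl_ge j W : bounded W -> (j.+1 < M)%N -> {in W, forall e, j.+1 \notin e.1} ->
  freq mu (muln N) W ^+ 2 <= freq mu (muln N) (dbl j W) + 7 * delta.
Proof.
move=> WM jM Wj.
have d_ge0 : 0 <= delta by apply: le_trans N_large; rewrite invr_ge0 ler0n.
have pairs r s := @pair_freq_le j W _ r s WM jM Wj (lexx _).
have /andP[f0 _] := freq01 mu_distr (muln N) (dbl j W).
set m : R := N%:R^-1 * \sum_(r < N) freq mu (move j r) W.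
have msqr : m ^+ 2 <= N%:R^-1 + (freq mu (muln N) (dbl j W) + 2 * delta).
  apply: (mean_sqr_le mu_distr (Y := fun r c => occurs c (move j r) W) N_gt0) => //.
  by rewrite addr_ge0 ?mulr_ge0.
have lb : freq mu (muln N) W - 2 * delta <= m.
  apply: mean_ge => // r.
  have := freq_spread (F := W) mu_spr (move_embed j (ltn_ord r)) scale_embed dM WM.
  rewrite ler_norml => /andP[]; lra.
have m1 : m <= 1 by apply: mean_le => // r; exact: prob_le1.
have m0 : 0 <= m by apply: mean_ge => // r; exact: prob_ge0.
have /andP[W0 W1] := freq01 mu_distr (muln N) W.
have : freq mu (muln N) W ^+ 2 <= m ^+ 2 + 4 * delta; last first.
  by move: msqr N_large; clearbody m; move: (N%:R^-1) => q; lra.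
have [Wm|/ltW mW] := leP (freq mu (muln N) W) m; nra.
Qed.

(** Moment errors of order [k ^+ 2] give a squared error of at most [10 * k ^+ 2], rounded up to
    [(4 * k) ^+ 2]. Returning from the average to the fixed placement costs [2 * delta], at most
    [2 * k]. *)
Lemma freq_decouple j W Z c k : bounded W -> bounded Z -> (j.+1 < M)%N ->
  {in W, forall e, j.+1 \notin e.1} -> {in Z, forall e, j \notin e.1} ->
  0 <= c <= 1 -> 0 <= k <= 1 -> delta <= k ^+ 2 ->
  `|freq mu (muln N) W - c| <= k ^+ 2 ->
  freq mu (muln N) (dbl j W) <= c ^+ 2 + k ^+ 2 ->
  `|freq mu (muln N) (W ++ Z) - c * freq mu (muln N) Z| <= 6 * k.
Proof.
move=> WM ZM jM Wj Zj /andP[c0 c1] /andP[k0 k1] dk Wc W2c.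
have d_ge0 : 0 <= delta by apply: le_trans N_large; rewrite invr_ge0 ler0n.
have pairs r s := @pair_freq_le j W _ r s WM jM Wj W2c.
have b0 : 0 <= c ^+ 2 + k ^+ 2 + 2 * delta by nra.
have single (r : 'I_N) : c - (k ^+ 2 + 2 * delta) <=
    prob mu (fun x => occurs x (move j r) W).
  have := freq_spread (F := W) mu_spr (move_embed j (ltn_ord r)) scale_embed dM WM.
  by move: Wc; rewrite /freq !ler_norml => /andP[? ?] /andP[? ?]; lra.
have := block_mean_decouple mu_distr (Y := fun r c => occurs c (move j r) W) N_gt0
  (fun x => occurs x (muln N) Z) pairs b0 c0 single.
have spr (r : 'I_N) : `|freq mu (move j r) (W ++ Z) - freq mu (muln N) (W ++ Z)| <= 2 * delta.
  apply: (freq_spread mu_spr (move_embed j (ltn_ord r)) scale_embed dM).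
  by move=> e; rewrite mem_cat => /orP[/WM|/ZM].
(* [Z] avoids [j], so it does not move while [j] slides. *)
have joint (r : 'I_N) : prob mu (fun x => occurs x (move j r) W && occurs x (muln N) Z)
    = freq mu (move j r) (W ++ Z).
  apply: eq_prob => x; rewrite occurs_cat; congr andb.
  apply: eq_in_occurs => e eZ y ye; rewrite /move; case: eqP => [yj|]; rewrite ?addn0 //.
  by have := Zj e eZ; rewrite -yj ye.
under eq_bigr do rewrite joint.
set m := (_ * \sum_r _); rewrite -/(freq mu (muln N) Z).
have mlb : freq mu (muln N) (W ++ Z) - 2 * delta <= m.
  by apply: mean_ge => // r; have := spr r; rewrite ler_norml => /andP[]; lra.
have mub : m <= freq mu (muln N) (W ++ Z) + 2 * delta.
  by apply: mean_le => // r; have := spr r; rewrite ler_norml => /andP[]; lra.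
move=> sqr_le.
have sqr_le' : (m - c * freq mu (muln N) Z) ^+ 2 <= (4 * k) ^+ 2.
  have e0 : 0 <= k ^+ 2 + 2 * delta by nra.
  have ce : c * (k ^+ 2 + 2 * delta) <= k ^+ 2 + 2 * delta by rewrite ler_piMl.
  have -> : (4 * k) ^+ 2 = 16 * k ^+ 2 by ring.
  apply: le_trans sqr_le _; move: N_large ce dk; move: (N%:R^-1) => q; lra.
have {sqr_le'}: `|m - c * freq mu (muln N) Z| <= 4 * k.
  by rewrite -(@ler_pXn2r _ 2) ?nnegrE ?mulr_ge0 // real_normK ?num_real.
rewrite !ler_norml => /andP[? ?]; apply/andP; split; nra.
Qed.

End Blocks.

(** * Boxes *)

Section Box.
Variables (n d N M : nat) (e : seq nat).
Hypotheses (N_gt0 : (0 < N)%N) (MN : (M * N <= n)%N).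
Hypotheses (e_sorted : sorted ltn e) (e_size : size e = d).
Hypothesis e_even : {in e, forall x, ~~ odd x && (x.+1 < M)%N}.

Lemma vertex_subproof (i : 'I_d) (b : bool) : (N * (nth 0%N e i + b) < n)%N.
Proof.
have /e_even/andP[_ iM] : nth 0%N e i \in e by rewrite mem_nth ?e_size.
case: b; nia.
Qed.

(** The placement under [muln N] of the [i]-th vertex of [e], or of its double when [b] holds. *)
Definition vertex i b : 'I_n := Ordinal (vertex_subproof i b).

(** Distinct entries of [e] are even and so differ by at least 2; the double of the smaller one
    stays below the larger one. *)
Lemma vertex_lt (i j : 'I_d) b b' : (i < j)%N -> (vertex i b < vertex j b')%N.
Proof.
move=> ij /=; rewrite ltn_pmul2l //.
have /e_even/andP[i_even _] : nth 0%N e i \in e by rewrite mem_nth ?e_size.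
have /e_even/andP[j_even _] : nth 0%N e j \in e by rewrite mem_nth ?e_size.
have : (nth 0%N e i < nth 0%N e j)%N.
  by apply: (sorted_ltn_nth ltn_trans) => //; rewrite inE e_size.
by case: b b' => -[]; lia.
Qed.

Lemma vertex_inj i j b b' : vertex i b = vertex j b' -> i = j /\ b = b'.
Proof.
move=> eq_ij; have eqij : i = j.
  apply/val_inj/eqP; have [ij|ji|//] := ltngtP (val i) (val j).
    by have := vertex_lt b b' ij; rewrite eq_ij ltnn.
  by have := vertex_lt b' b ji; rewrite eq_ij ltnn.
split=> //; move: eq_ij => /(congr1 val) /= /eqP.
by rewrite eqn_pmul2l // eqij eqn_add2l; case: b b' => -[].
Qed.

Lemma card_box_edge (b : {ffun 'I_d -> bool}) : #|[set vertex i (b i) | i : 'I_d]| == d.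
Proof. by rewrite card_imset ?card_ord // => i j /vertex_inj[]. Qed.

Definition box_edge (b : {ffun 'I_d -> bool}) : dsub n d :=
  exist _ [set vertex i (b i) | i : 'I_d] (card_box_edge b).

Definition box_sides (i : 'I_d) : {set 'I_n} := [set vertex i b | b : bool].

Lemma box_sides_seq : is_box_seq box_sides.
Proof.
split=> [i|i j ij x y /imsetP[b _ ->] /imsetP[b' _ ->]].
  by rewrite card_imset ?card_bool // => b b' /vertex_inj[].
by apply: vertex_lt; rewrite ij.
Qed.

Lemma box_edge_inj : injective box_edge.
Proof.
move=> b b' eq_b; apply/ffunP => i.
have : vertex i (b i) \in val (box_edge b') by rewrite -eq_b; apply: imset_f.
by move=> /imsetP[j _ /vertex_inj[-> ]].
Qed.

(** An edge of the box picks one vertex from each of the [d] sides, and these picks exhaust its [d]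
    elements. *)
Lemma box_edges : box box_sides = [set box_edge b | b : {ffun 'I_d -> bool}].
Proof.
apply/setP => s; rewrite inE; apply/forallP/imsetP => [s_box|[b _ ->] i].
  pose b := [ffun i => vertex i true \in val s].
  exists b => //; apply/val_inj/esym/eqP => /=.
  rewrite eqEcard (eqP (card_box_edge b)) (eqP (valP s)) leqnn andbT.
  apply/subsetP => _ /imsetP[i _ ->]; rewrite ffunE.
  case: (boolP (vertex i true \in val s)) => // si.
  have /cards1P[x sx] := s_box i.
  have : x \in val s :&: box_sides i by rewrite sx set11.
  rewrite inE => /andP[xs /imsetP[[] _ xE]]; last by rewrite -xE.
  by rewrite xE (negPf si) in xs.
apply/cards1P; exists (vertex i (b i)); apply/setP => x; rewrite !inE.
apply/andP/eqP => [[/imsetP[j _ ->] /imsetP[c _ /vertex_inj[-> _]]] //|->].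
by split; apply: imset_f.
Qed.

Context {R : realType} {X : finType} (mu : cfg X n d -> R) (delta : R) (S : {set X}).
Hypotheses (mu_distr : is_distr mu) (mu_spr : spreadable delta mu).
Hypothesis mu_box : box_independent delta S mu.

(** Box independence costs [delta], and replacing each of the [2 ^ d] edge probabilities by
    [rate mu a] costs [2 * delta]. *)
Lemma freq_full_box_le P a : a \in S -> perm_eq P e ->
  freq mu (muln N) (dbls P [:: (e, a)]) <=
  weight mu (dbls P [:: (e, a)]) + (1 + 2 ^+ d.+1) * delta.
Proof.
move=> aS Pe.
have memP := perm_mem Pe.
have e_uniq : uniq e by apply: sorted_uniq e_sorted; [exact: ltn_trans|exact: ltnn].
have P_uniq : uniq P by rewrite (perm_uniq Pe).
have ev : {in e, forall x, ~~ odd x} by move=> x /e_even/andP[].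
apply: (@le_trans _ _ (prob mu (fun c => [forall s in box box_sides, c s == a]))).
  apply: prob_le => // c /allP occ; apply/forall_inP => s; rewrite box_edges.
  move=> /imsetP[b _ ->].
  (* The choice [b], indexed by positions in [e], is turned into a predicate on vertices. *)
  pose b' x := [exists i : 'I_d, (nth 0%N e i == x) && b i].
  have Pev : {in P, forall x, ~~ odd x} by move=> x; rewrite memP; exact: ev.
  have := occ _ (dbls_shifts a b' P_uniq Pev ev).
  rewrite (@value_dsub _ _ _ c (box_edge b)) //= => v.
  rewrite -map_comp; apply/imsetP/mapP => [[i _ ->]|[x xe vx]].
    exists (nth 0%N e i); rewrite ?mem_nth ?e_size //= memP mem_nth ?e_size // andbT.
    congr (_ * (_ + _))%N; congr nat_of_bool; apply/idP/existsP => [bi|[j /andP[ij]]].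
      by exists i; rewrite eqxx.
    by rewrite nth_uniq ?e_size // in ij; rewrite -(val_inj (eqP ij)).
  have xd : (index x e < d)%N by rewrite -e_size index_mem.
  exists (Ordinal xd) => //; apply: val_inj; rewrite [LHS]vx /= nth_index // memP xe andbT.
  congr (_ * (_ + _))%N; congr nat_of_bool; apply/existsP/idP => [[j /andP[/eqP jx bj]]|bi].
    suff -> : Ordinal xd = j by [].
    by apply: val_inj => /=; rewrite -jx index_uniq ?e_size.
  by exists (Ordinal xd); rewrite /= nth_index ?eqxx.
apply: le_trans (mu_box box_sides_seq aS) _.
rewrite box_edges big_imset /=; last by move=> b b' _ _; exact: box_edge_inj.
rewrite weight_dbls_single (perm_size Pe) e_size.
have : `|\prod_(b in {ffun 'I_d -> bool}) prob mu (fun c => c (box_edge b) == a) -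
   \prod_(b in {ffun 'I_d -> bool}) rate mu a| <=
   (count (mem {ffun 'I_d -> bool}) (index_enum {ffun 'I_d -> bool}))%:R * (2 * delta).
  apply: norm_prod_diff_le => b _; rewrite ?prob_ge0 ?prob_le1 //.
  exact: rate_dsub.
rewrite prodr_const card_ffun card_bool card_ord.
have -> : count (mem {ffun 'I_d -> bool}) (index_enum {ffun 'I_d -> bool}) = (2 ^ d)%N.
  by rewrite -sum1_count sum1_card card_ffun card_bool card_ord.
rewrite natrX mulrA -exprSr ler_norml => /andP[_]; lra.
Qed.

End Box.

(** * Induction on the common vertices *)

Section Regular.
Context {R : realType}.

(** One [delta] bounds all three errors: spreadability, box independence and [1/N]. There are [M]
    blocks of length [N]. *)
Definition regular (delta : R) d (X : finType) (S : {set X}) n (mu : cfg X n d -> R) N M :=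
  [/\ is_distr mu, spreadable delta mu, box_independent delta S mu &
      [/\ (0 < N)%N, N%:R^-1 <= delta, (M * N <= n)%N & (d <= M)%N]].

(** Lets the inductions combine finitely many thresholds by taking their minimum. *)
Lemma regular_mono delta delta' d X S n mu N M : delta <= delta' ->
  @regular delta d X S n mu N M -> @regular delta' d X S n mu N M.
Proof.
move=> dd' [mu_distr spr bx [N0 Nd MN dM]]; split => //.
- by move=> J K HJK dJ; apply: le_trans dd'; exact: spr.
- by move=> H Hs a aS; apply: le_trans (bx H Hs a aS) _; rewrite lerD2l.
- by split => //; exact: le_trans dd'.
Qed.

(* Vertices are even so that the successor of a vertex is a free slot for its double. *)
Definition good_edge d M (e : seq nat) :=
  [/\ sorted ltn e, size e = d & {in e, forall x, ~~ odd x && (x.+1 < M)%N}].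

Lemma good_edge_uniq d M e : good_edge d M e -> uniq e.
Proof. by case=> + _ _; apply: sorted_uniq; [exact: ltn_trans|exact: ltnn]. Qed.

Lemma uniq_not_subset (s t : seq nat) : uniq s -> (size t < size s)%N ->
  exists2 x, x \in s & x \notin t.
Proof.
move=> s_uniq ts; apply/hasP; rewrite has_predC; apply/negP => /allP st.
by have := uniq_leq_size s_uniq st; rewrite leqNgt ts.
Qed.

Section Doubles.
Context {X : finType} (d M : nat) (P : seq nat) (L : seq (seq nat * X)).
Hypothesis L_good : {in L, forall f, good_edge d M f.1}.

Lemma dbls_bounded : {in P, forall x, x.+1 < M}%N -> bounded M (dbls P L).
Proof.
move=> PM e /mem_dbls[f [/L_good[_ _ fM] _ ef]] x /ef[/fM/andP[_ /ltnW //]|[y /PM yM -> //]].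
Qed.

(** The odd number [j + 1] can only appear as the double of [j], and [j] has not been doubled. *)
Lemma dbls_avoid_succ j : ~~ odd j -> j \notin P ->
  {in dbls P L, forall e, j.+1 \notin e.1}.
Proof.
move=> j_even jP e /mem_dbls[f [/L_good[_ _ fM] _ ef]]; apply/negP => /ef[/fM|[y yP [jy]]].
  by rewrite /= j_even.
by rewrite jy yP in jP.
Qed.

Lemma dbls_avoid j : ~~ odd j -> {in P, forall x, ~~ odd x} ->
  {in L, forall f, j \notin f.1} -> {in dbls P L, forall e, j \notin e.1}.
Proof.
move=> j_even P_even Lj e /mem_dbls[f [fL _ ef]]; apply/negP => /ef[jf|[y /P_even + jy]].
  by have := Lj f fL; rewrite jf.
by move: j_even; rewrite jy /= => /negPn ->.
Qed.

End Doubles.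

(** Downward induction from the full box: [t] bounds the number of vertices of [e] not yet doubled,
    and an upper bound after one more doubling yields one before it. *)
Lemma freq_box_le d t (eps : R) : 0 < eps -> exists2 delta : R, 0 < delta &
  forall (X : finType) (S : {set X}) n (mu : cfg X n d -> R) N M, regular delta S mu N M ->
  forall P e a, a \in S -> good_edge d M e -> uniq P -> {subset P <= e} ->
  (d <= size P + t)%N ->
  freq mu (muln N) (dbls P [:: (e, a)]) <= weight mu (dbls P [:: (e, a)]) + eps.
Proof.
elim: t eps => [|t IH] eps eps0.
  have K0 : 0 < 1 + 2 ^+ d.+1 :> R by rewrite ltr_pwDl ?exprn_ge0.
  exists (eps / (1 + 2 ^+ d.+1)); first by rewrite divr_gt0.
  move=> X S n mu N M [mu_distr spr bx [N0 Nd MN dM]] P e a aS e_good P_uniq Pe.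
  rewrite addn0 => dP; have e_uniq := good_edge_uniq e_good.
  case: e_good => e_sorted e_size e_even.
  have Pe' : perm_eq P e.
    by apply: uniq_perm => //; apply: (uniq_min_size P_uniq Pe _).2; rewrite e_size.
  have := freq_full_box_le N0 MN e_sorted e_size e_even mu_distr spr bx aS Pe'.
  by rewrite mulrC divfK ?gt_eqF.
(* With [w] the weight before doubling, [eps ^+ 2 / 2] and [7 * delta] add up to at most [eps ^+ 2],
   so the squared frequency is at most [(w + eps) ^+ 2]. *)
have [|d1 d1_gt0 H1] := IH (eps ^+ 2 / 2); first by rewrite divr_gt0 ?exprn_gt0.
have [d2 d2_gt0 H2] := IH _ eps0.
exists (Num.min d1 (Num.min d2 (eps ^+ 2 / 14))).
  by rewrite !lt_min d1_gt0 d2_gt0 divr_gt0 ?exprn_gt0.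
move=> X S n mu N M; set delta := Num.min _ _ => reg P e a aS e_good P_uniq Pe.
have [dd1 dd2 dd3] : [/\ delta <= d1, delta <= d2 & delta <= eps ^+ 2 / 14].
  by split; rewrite !ge_min lexx ?orbT.
case: (leqP d (size P + t)%N) => [dP _|Pd dP].
  exact: (H2 X S n mu N M (regular_mono dd2 reg)).
have [mu_distr spr bx [N0 Nd MN dM]] := reg.
have [|j je jP] := uniq_not_subset (good_edge_uniq e_good) (t := P).
  by case: e_good => _ -> _; apply: leq_trans Pd; rewrite ltnS leq_addr.
have L_good : {in [:: (e, a)], forall f, good_edge d M f.1}.
  by move=> f /[!inE] /eqP ->.
have [e_sorted e_size e_even] := e_good.
have /andP[j_even jM] := e_even _ je.
have PM : {in P, forall x, x.+1 < M}%N by move=> x /Pe /e_even /andP[].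
have := H1 X S n mu N M (regular_mono dd1 reg) (j :: P) e a aS e_good.
rewrite /= jP P_uniq => /(_ isT) /=.
have jPe : {subset j :: P <= e} by move=> x /[!inE] /orP[/eqP ->|/Pe].
move=> /(_ jPe); rewrite addSnnS => /(_ dP).
rewrite weight_dbl => up.
have := freq_dbl_ge mu_distr spr N0 Nd MN dM (dbls_bounded L_good PM) jM
  (dbls_avoid_succ L_good j_even jP).
have /andP[w0 _] := weight01 mu_distr (dbls P [:: (e, a)]).
have /andP[f0 _] := freq01 mu_distr (muln N) (dbls P [:: (e, a)]).
move: up dd3; set f := freq _ _ (dbls P _); set w := weight _ _; set f2 := freq _ _ _.
rewrite -/f -/w in f0 w0 * => up dd3 down.
have : f ^+ 2 <= (w + eps) ^+ 2 by nra.
by rewrite ler_pXn2r // nnegrE addr_ge0 // ltW.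
Qed.

Lemma freq_edge_ge delta d (X : finType) (S : {set X}) n (mu : cfg X n d -> R) N M
  (e : seq nat) a : regular delta S mu N M -> good_edge d M e ->
  weight mu [:: (e, a)] - 2 * delta <= freq mu (muln N) [:: (e, a)].
Proof.
move=> [mu_distr spr bx [N0 Nd MN dM]] [e_sorted e_size e_even].
have -> : freq mu (muln N) [:: (e, a)] =
    prob mu (fun c => value c (map (muln N) e) == Some a).
  by apply: eq_prob => c; rewrite /occurs /= andbT.
suff : `|prob mu (fun c => value c (map (muln N) e) == Some a) - rate mu a| <= 2 * delta.
  by rewrite /weight big_seq1 ler_norml => /andP[/= ? _]; lra.
apply: rate_spread => //; first by apply: leq_trans MN; nia.
- by rewrite (homo_sorted _ _ e_sorted) // => x y; rewrite /= ltn_pmul2l.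
- by rewrite size_map.
- by move=> _ /mapP[x /e_even /andP[_ xM] ->]; nia.
Qed.

(** Upward induction from a single edge, since each doubling at least squares the frequency. *)
Lemma freq_box_ge d p (eps : R) : 0 < eps -> exists2 delta : R, 0 < delta &
  forall (X : finType) (S : {set X}) n (mu : cfg X n d -> R) N M, regular delta S mu N M ->
  forall P e a, good_edge d M e -> uniq P -> {subset P <= e} ->
  (size P <= p)%N ->
  weight mu (dbls P [:: (e, a)]) - eps <= freq mu (muln N) (dbls P [:: (e, a)]).
Proof.
elim: p eps => [|p IH] eps eps0.
  exists (eps / 2); first by rewrite divr_gt0.
  move=> X S n mu N M reg [|//] e a e_good _ _ _.
  by have := freq_edge_ge a reg e_good; rewrite /=; apply: le_trans; lra.
(* Squaring numbers in [0,1] at most doubles the error, giving [eps / 2]; the other half absorbs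
   [7 * delta]. *)
have [|d1 d1_gt0 H1] := IH (eps / 4); first by rewrite divr_gt0.
exists (Num.min d1 (eps / 14)); first by rewrite lt_min d1_gt0 divr_gt0.
move=> X S n mu N M; set delta := Num.min _ _ => reg.
have [dd1 dd2] : delta <= d1 /\ delta <= eps / 14.
  by split; rewrite ge_min lexx ?orbT.
case=> [|j P] e a e_good.
  by have := freq_edge_ge a reg e_good; rewrite /= => H _ _ _; apply: le_trans H; lra.
move=> /= /andP[jP P_uniq] jPe Pp.
have Pe : {subset P <= e} by move=> x xP; apply: jPe; rewrite inE xP orbT.
have low := H1 X S n mu N M (regular_mono dd1 reg) P e a e_good P_uniq Pe Pp.
have [mu_distr spr bx [N0 Nd MN dM]] := reg.
have L_good : {in [:: (e, a)], forall f, good_edge d M f.1}.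
  by move=> f /[!inE] /eqP ->.
have [e_sorted e_size e_even] := e_good.
have /andP[j_even jM] := e_even j (jPe j (mem_head _ _)).
have PM : {in P, forall x, x.+1 < M}%N by move=> x /Pe /e_even /andP[].
have := freq_dbl_ge mu_distr spr N0 Nd MN dM (dbls_bounded L_good PM) jM
  (dbls_avoid_succ L_good j_even jP).
rewrite weight_dbl.
have /andP[w0 w1] := weight01 mu_distr (dbls P [:: (e, a)]).
have /andP[f0 f1] := freq01 mu_distr (muln N) (dbls P [:: (e, a)]).
move: low dd2; set f := freq _ _ (dbls P _); set w := weight _ _; set f2 := freq _ _ _.
rewrite -/f -/w in f0 f1 w0 w1 * => low dd2 up.
have : w ^+ 2 - eps / 2 <= f ^+ 2; last by move: up dd2; clearbody f f2 w delta; lra.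
clear up dd2; clearbody f w; have [wf|/ltW fw] := leP w f; nra.
Qed.

Lemma freq_box d (eps : R) : 0 < eps -> exists2 delta : R, 0 < delta &
  forall (X : finType) (S : {set X}) n (mu : cfg X n d -> R) N M, regular delta S mu N M ->
  forall P e a, a \in S -> good_edge d M e -> uniq P -> {subset P <= e} ->
  `|freq mu (muln N) (dbls P [:: (e, a)]) - weight mu (dbls P [:: (e, a)])| <= eps.
Proof.
move=> eps0.
have [d1 d1_gt0 H1] := freq_box_le d d eps0.
have [d2 d2_gt0 H2] := freq_box_ge d d eps0.
exists (Num.min d1 d2); first by rewrite lt_min d1_gt0.
move=> X S n mu N M; set delta := Num.min _ _ => reg P e a aS e_good P_uniq Pe.
have [dd1 dd2] : delta <= d1 /\ delta <= d2.
  by split; rewrite ge_min lexx ?orbT.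
have := H1 X S n mu N M (regular_mono dd1 reg) P e a aS e_good P_uniq Pe (leq_addl _ _).
have Pd : (size P <= d)%N by case: e_good => _ <- _; exact: uniq_leq_size.
have := H2 X S n mu N M (regular_mono dd2 reg) P e a e_good P_uniq Pe Pd.
rewrite ler_norml => ? ?; apply/andP; split; lra.
Qed.

Lemma freq_dbls_nil (eps : R) d X n (mu : cfg X n d -> R) phi P : 0 < eps -> is_distr mu ->
  `|freq mu phi (dbls P [::]) - weight mu (dbls P [::])| <= eps.
Proof.
move=> eps0 [_ mu1]; rewrite dbls_nil /weight big_nil /freq /prob /= mu1.
by rewrite subrr normr0 ltW.
Qed.

(* C is the set of vertices common to all edges of L, and P the part of C that has been
   doubled; the induction is on the number t of vertices an edge has outside C. *)
Lemma freq_dbls d t k (eps : R) : 0 < eps -> exists2 delta : R, 0 < delta &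
  forall (X : finType) (S : {set X}) n (mu : cfg X n d -> R) N M, regular delta S mu N M ->
  forall (C P : seq nat) (L : seq (seq nat * X)),
  uniq C -> (size C + t = d)%N -> uniq P -> {subset P <= C} ->
  {in L, forall f, [/\ good_edge d M f.1, f.2 \in S & {subset C <= f.1}]} ->
  uniq (map fst L) -> (size L <= k)%N ->
  `|freq mu (muln N) (dbls P L) - weight mu (dbls P L)| <= eps.
Proof.
elim: t k eps => [|t IHt] k; last elim: k => [|k IHk].
- move=> eps eps0; have [delta delta0 H] := freq_box d eps0.
  exists delta => // X S n mu N M reg C P [|[e a] L] C_uniq Cd P_uniq PC L_good L_uniq _.
    by apply: freq_dbls_nil => //; case: reg.
  have [[e_sorted e_size e_even] aS Ce] := L_good _ (mem_head _ _).
  (* When [C] has [d] elements, every edge is the increasing list of [C], so distinct edges leave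
     only one. *)
  suff -> : L = [::].
    by apply: (H _ _ _ _ _ _ reg) => // x /PC /Ce.
  case: L L_good L_uniq => // [[e' a']] L L_good /= /andP[/negP[]].
  have [|[/= e'_sorted e'_size e'_even] _ Ce'] := L_good (e', a').
    by rewrite !inE eqxx orbT.
  have same f : sorted ltn f -> size f = d -> {subset C <= f} -> C =i f.
    move=> f_sorted f_size Cf; apply: (uniq_min_size C_uniq Cf _).2.
    by rewrite f_size -Cd addn0.
  rewrite inE; apply/orP; left; apply/eqP.
  apply: (irr_sorted_eq ltn_trans ltnn) => // x.
  by rewrite -same // (same e').
- move=> eps eps0; exists 1 => // X S n mu N M [mu_distr _ _ _] C P [|//] *.
  exact: freq_dbls_nil.
move=> eps eps0.
(* The parameter [k] of [freq_decouple]: its error [6 * r] is at most [eps / 2]. *)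
pose r := Num.min 1 eps / 12.
have r0 : 0 < r by rewrite divr_gt0 // lt_min ltr01.
have [r1 re] : r <= 1 /\ r <= eps / 12.
  split; rewrite /r ?ler_pM2r ?invr_gt0 ?ge_min ?lexx ?orbT //.
  by rewrite ler_pdivrMr // mul1r ge_min (@le_trans _ _ 1) // ler1n.
have r2 : 0 < r ^+ 2 by rewrite exprn_gt0.
(* The star of [j] may be the whole of [L] but has one more common vertex; the rest loses at least
   the edge [f0]. *)
have [d1 d1_gt0 H1] := IHt k.+1 _ r2.
have [|d2 d2_gt0 H2] := IHk (eps / 2); first by rewrite divr_gt0.
exists (Num.min d1 (Num.min d2 (r ^+ 2))); first by rewrite !lt_min d1_gt0 d2_gt0.
move=> X S n mu N M; set delta := Num.min _ _ => reg C P L.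
have [dd1 dd2 dd3] : [/\ delta <= d1, delta <= d2 & delta <= r ^+ 2].
  by split; rewrite !ge_min lexx ?orbT.
have [mu_distr spr bx [N0 Nd MN dM]] := reg.
case: L => [|f0 L'] C_uniq Cd P_uniq PC; first by move=> *; exact: freq_dbls_nil.
set L := f0 :: L' => L_good L_uniq Lk.
have f0L : f0 \in L by exact: mem_head.
have [f0_good _ Cf0] := L_good _ f0L; have [_ f0_size f0_even] := f0_good.
have [|j jf0 jC] := uniq_not_subset (good_edge_uniq f0_good) (t := C).
  by rewrite f0_size -Cd addnS ltnS leq_addr.
have /andP[j_even jM] := f0_even _ jf0.
have C_even : {in C, forall x, ~~ odd x && (x.+1 < M)%N} by move=> x /Cf0 /f0_even.
have jP : j \notin P by apply: contra jC => /PC.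
pose W0 := [seq f <- L | j \in f.1]; pose Z0 := [seq f <- L | j \notin f.1].
have LWZ : perm_eq (dbls P L) (dbls P W0 ++ dbls P Z0).
  apply: perm_trans (perm_dbls_cat P W0 Z0); apply: perm_dbls.
  by rewrite perm_sym; apply/permPl; exact: perm_filterC.
rewrite (freq_perm _ _ LWZ) (weight_perm _ LWZ) weight_cat.
have W_good : {in W0, forall f, good_edge d M f.1}.
  by move=> f; rewrite mem_filter => /andP[_ /L_good[]].
have Z_good : {in Z0, forall f, good_edge d M f.1}.
  by move=> f; rewrite mem_filter => /andP[_ /L_good[]].
have W_good' : {in W0, forall f, [/\ good_edge d M f.1, f.2 \in S & {subset j :: C <= f.1}]}.
  move=> f; rewrite mem_filter => /andP[jf /L_good[f_good fS Cf]].
  by split=> // x /[!inE] /orP[/eqP ->|/Cf].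
have Z_good' : {in Z0, forall f, [/\ good_edge d M f.1, f.2 \in S & {subset C <= f.1}]}.
  by move=> f; rewrite mem_filter => /andP[_ /L_good].
have W_uniq : uniq (map fst W0).
  by apply: subseq_uniq L_uniq; apply: map_subseq; exact: filter_subseq.
have Z_uniq : uniq (map fst Z0).
  by apply: subseq_uniq L_uniq; apply: map_subseq; exact: filter_subseq.
have Wk : (size W0 <= k.+1)%N by apply: leq_trans Lk; rewrite size_filter count_size.
have Zk : (size Z0 <= k)%N.
  rewrite -ltnS; apply: leq_trans Lk; rewrite /Z0 /L /= jf0 /= ltnS.
  by rewrite size_filter count_size.
have jC_uniq : uniq (j :: C) by rewrite /= jC.
have jCd : (size (j :: C) + t = d)%N by rewrite /= addSnnS.
have HW := H1 X S n mu N M (regular_mono dd1 reg) (j :: C) P W0 jC_uniq jCd P_uniq.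
have {HW} freqW := HW (fun x xP => mem_behead (s := j :: C) (PC x xP)) W_good' W_uniq Wk.
have jP_uniq : uniq (j :: P) by rewrite /= jP.
have jPC : {subset j :: P <= j :: C}.
  by move=> x /[!inE] /orP[->//|/PC ->]; rewrite orbT.
have := H1 X S n mu N M (regular_mono dd1 reg) (j :: C) (j :: P) W0 jC_uniq jCd jP_uniq
  jPC W_good' W_uniq Wk.
rewrite /= weight_dbl ler_norml => /andP[_ freqW2].
have freqZ := H2 X S n mu N M (regular_mono dd2 reg) C P Z0 C_uniq Cd P_uniq PC
  Z_good' Z_uniq Zk.
have PM : {in P, forall x, x.+1 < M}%N by move=> x /PC /C_even /andP[].
have P_even : {in P, forall x, ~~ odd x} by move=> x /PC /C_even /andP[].
have Zj : {in Z0, forall f, j \notin f.1} by move=> f; rewrite mem_filter => /andP[].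
have w01 := weight01 mu_distr (dbls P W0).
have r01 : 0 <= r <= 1 by rewrite ltW.
have := freq_decouple mu_distr spr N0 Nd MN dM (dbls_bounded W_good PM)
  (dbls_bounded Z_good PM) jM (dbls_avoid_succ W_good j_even jP)
  (dbls_avoid j_even P_even Zj) w01 r01 dd3 freqW.
rewrite addrC -lerBlDr => /(_ freqW2); case/andP: w01.
(* Decoupling gives [wz] near [wW * z], and [z] is near [wZ]; each error is at most [eps / 2]
   because [wW] is at most 1. *)
move: freqZ; move: (freq _ _ _) (freq _ _ _) (weight _ _) (weight _ _) => z wz wW wZ.
rewrite ler_norml => /andP[? ?] w0 w1; rewrite !ler_norml => /andP[? ?].
by apply/andP; split; nra.
Qed.

End Regular.

(** * Transfer to arbitrary families of edges *)

Section Ranks.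
Variables (n d : nat) (F : {set dsub n d}).

Definition vertices : {set 'I_n} := \bigcup_(s in F) val s.

Definition unrank (x : nat) : nat := nth 0%N (map val (enum vertices)) x.

(** Renames each vertex by its position among all vertices of [F], so the labels are bounded in
    terms of [#|F|] and [d], independently of [n]. *)
Definition ranks (s : dsub n d) : seq nat :=
  [seq x <- iota 0 #|vertices| | unrank x \in map val (enum (val s))].

Lemma card_vertices_le : (#|vertices| <= #|F| * d)%N.
Proof.
rewrite -sum_nat_const /vertices; elim/big_rec2: _ => [|s k A _ IH]; first by rewrite cards0.
by rewrite cardsU (eqP (valP s)); lia.
Qed.

Lemma unrank_embed : mono_embed #|vertices| n unrank.
Proof.
have sz : size (map val (enum vertices)) = #|vertices| by rewrite size_map -cardE.
split=> [x y /andP[xy ym]|x xm].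
  apply: (sorted_ltn_nth ltn_trans 0%N (sorted_enum_ord vertices)) => //.
    by rewrite inE sz (ltn_trans xy).
  by rewrite inE sz.
have /mapP[i _ ->] : unrank x \in map val (enum vertices) by rewrite mem_nth ?sz.
exact: ltn_ord.
Qed.

Lemma unrank_ranks s : s \in F -> map unrank (ranks s) = map val (enum (val s)).
Proof.
move=> sF; have -> : map unrank (ranks s) =
    [seq x <- map val (enum vertices) | x \in map val (enum (val s))].
  rewrite -[in RHS](mkseq_nth 0%N (map val (enum vertices))) size_map -cardE.
  by rewrite filter_map.
apply: (irr_sorted_eq ltn_trans ltnn).
- by apply: sorted_filter; [exact: ltn_trans|exact: sorted_enum_ord].
- exact: sorted_enum_ord.
move=> x; rewrite mem_filter; case: (boolP (x \in map val (enum (val s)))) => //.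
move=> /mapP[i /[!mem_enum] si ->]; rewrite mem_map ?mem_enum; last exact: val_inj.
by apply/bigcupP; exists s.
Qed.

Lemma ranks_sorted s : sorted ltn (ranks s).
Proof. by apply: sorted_filter; [exact: ltn_trans|exact: iota_ltn_sorted]. Qed.

Lemma size_ranks s : s \in F -> size (ranks s) = d.
Proof.
by move=> sF; rewrite -(size_map unrank) unrank_ranks // size_map -cardE (eqP (valP s)).
Qed.

Lemma ranks_inj : {in F &, injective ranks}.
Proof.
move=> s t sF tF /(congr1 (map unrank)); rewrite !unrank_ranks //.
move=> /(inj_map val_inj) st; apply/val_inj/setP => i.
by rewrite -[LHS]mem_enum st mem_enum.
Qed.

Lemma ranks_lt s x : x \in ranks s -> (x < #|vertices|)%N.
Proof. by rewrite mem_filter mem_iota => /andP[_]. Qed.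

End Ranks.

Lemma box_independent_independent (R : realType) (d k : nat) (eps : R) :
  (0 < d)%N -> (0 < k)%N -> 0 < eps -> exists (n0 : nat) (delta : R), 0 < delta /\
  forall (X : finType) (S : {set X}) n (mu : cfg X n d -> R), (n0 <= n)%N ->
  is_distr mu -> spreadable delta mu -> box_independent delta S mu ->
  forall (F : {set dsub n d}) (a : dsub n d -> X), #|F| = k ->
  (forall s, s \in F -> a s \in S) ->
  `| prob mu (fun c => [forall s in F, c s == a s])
     - \prod_(s in F) prob mu (fun c => c s == a s) | <= eps.
Proof.
move=> d_gt0 k_gt0 eps0.
have [|d1 d1_gt0 H1] := @freq_dbls R d d k (eps / 2); first by rewrite divr_gt0.
(* Beyond the [eps / 2] from [freq_dbls], changing the placement costs [2 * delta] and the [k] edge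
   probabilities cost [2 * k * delta]. *)
pose delta := Num.min d1 (eps / (4 * k.+1%:R)).
have delta_gt0 : 0 < delta by rewrite lt_min d1_gt0 divr_gt0 ?mulr_gt0.
have [dd1 dd2] : delta <= d1 /\ (4 * k.+1%:R) * delta <= eps.
  split; first by rewrite ge_min lexx.
  by rewrite mulrC -ler_pdivlMr ?mulr_gt0 // ge_min lexx orbT.
(* The family has at most [k * d] vertices, and making their labels even doubles the range. Blocks
   of length at least [B] have [1/N] at most [delta]. *)
pose M := (2 * (k * d))%N; pose B := (Num.trunc delta^-1).+1.
exists (M * B)%N, delta; split=> // X S n mu nMB mu_distr spr bx F a Fk aS.
set N := (n %/ M)%N.
have M_gt0 : (0 < M)%N by rewrite !muln_gt0 k_gt0.
have BN : (B <= N)%N by rewrite leq_divRL // mulnC.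
have N_gt0 : (0 < N)%N by apply: leq_trans BN.
have MN : (M * N <= n)%N by rewrite mulnC leq_divM.
have Ndelta : N%:R^-1 <= delta.
  rewrite invf_ple ?posrE ?ltr0n //; apply: ltW; apply: lt_le_trans (truncnS_gt _) _.
  by rewrite ler_nat.
have [s0 s0F] : exists s, s \in F by apply/set0Pn; rewrite -card_gt0 Fk.
have mM : (2 * #|vertices F| <= M)%N.
  by rewrite /M leq_mul2l /= -Fk card_vertices_le.
have dm : (d <= #|vertices F|)%N.
  rewrite -[leqLHS](eqP (valP s0)) subset_leq_card //; exact: bigcup_sup.
have reg : regular delta S mu N M.
  by split=> //; split=> //; apply: leq_trans mM; lia.
pose F0 := [seq (ranks F s, a s) | s <- enum F].
pose L := [seq (map (muln 2) e.1, e.2) | e <- F0].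
have F0m : {in F0, forall e, {in e.1, forall x, (x < #|vertices F|)%N}}.
  by move=> _ /mapP[s _ ->] x /ranks_lt.
have probE : prob mu (fun c => [forall s in F, c s == a s]) = freq mu (unrank F) F0.
  apply: eq_prob => c; rewrite /occurs all_map.
  have valE s : s \in F -> value c (map (unrank F) (ranks F s)) = Some (c s).
    move=> sF; rewrite unrank_ranks //; apply: value_dsub => i.
    by rewrite mem_map ?mem_enum //; exact: val_inj.
  apply/forall_inP/allP => /= H s sF.
    by rewrite mem_enum in sF; rewrite valE // (eqP (H s sF)).
  by have := H s; rewrite mem_enum valE // => /(_ sF) /eqP[->].
have freqL : freq mu (muln N) L = freq mu (muln N \o muln 2) F0.
  by apply: eq_prob => c; rewrite occurs_comp.
have embed2 : mono_embed #|vertices F| n (muln N \o muln 2).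
  by split=> [x y|x] xm /=; nia.
have near_freq : `|freq mu (unrank F) F0 - freq mu (muln N) L| <= 2 * delta.
  rewrite freqL; apply: (freq_spread spr (unrank_embed F) embed2 dm).
  exact: F0m.
have L_good : {in L, forall f, [/\ good_edge d M f.1, f.2 \in S & {subset [::] <= f.1}]}.
  move=> _ /mapP[_ /mapP[s /[!mem_enum] sF ->] ->] /=; split=> //; last exact: aS.
  split.
  - by rewrite (homo_sorted _ _ (ranks_sorted F s)) // => x y; rewrite /= ltn_pmul2l.
  - by rewrite size_map size_ranks.
  - by move=> _ /mapP[x /ranks_lt xm ->]; rewrite oddM /=; lia.
have L_uniq : uniq (map fst L).
  rewrite /L /F0 -!map_comp map_inj_in_uniq ?enum_uniq // => s t.
  rewrite !mem_enum => sF tF /= /inj_map st; apply: (ranks_inj sF tF); apply: st.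
  by move=> x y /eqP; rewrite eqn_pmul2l // => /eqP.
have L_size : (size L <= k)%N by rewrite !size_map -cardE Fk.
(* The induction is entered with no common vertex and nothing doubled. *)
have := H1 X S n mu N M (regular_mono dd1 reg) [::] [::] L isT (add0n d) isT
  (fun x xP => xP) L_good L_uniq L_size.
have -> : weight mu (dbls [::] L) = \prod_(s in F) rate mu (a s).
  by rewrite /weight /= /L /F0 !big_map big_enum.
rewrite /= probE => near_weight.
have : `|\prod_(s in F) prob mu (fun c => c s == a s) - \prod_(s in F) rate mu (a s)| <=
    (count (mem F) (index_enum (dsub n d)))%:R * (2 * delta).
  apply: norm_prod_diff_le => s _; rewrite ?prob_ge0 ?prob_le1 //.
  exact: rate_dsub.
rewrite -sum1_count sum1_card Fk; rewrite -natr1 in dd2.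
move: near_freq near_weight; rewrite !ler_norml => /andP[? ?] /andP[? ?] /andP[? ?].
apply/andP; split; nra.
Qed.

Theorem theorem3p2 (R : realType) :
  exists gamma : R -> R -> nat -> nat -> nat -> R,
    (* positivity on the domain of definition *)
    (forall (eta theta : R) (d n k : nat),
        0 < eta <= 1 -> 0 < theta <= 1 -> (0 < d)%N -> (4 * d <= n)%N ->
        (1 <= k <= 'C(n./2, d))%N ->
        0 < gamma eta theta d n k)
    /\
    (* gamma_k -> 0 as n -> oo and eta, theta -> 0 (for fixed d, k) *)
    (forall (d k : nat), (0 < d)%N -> (0 < k)%N ->
       forall eps : R, 0 < eps ->
       exists (N : nat) (delta : R), 0 < delta /\
         forall (n : nat) (eta theta : R),
           (N <= n)%N -> (4 * d <= n)%N -> (k <= 'C(n./2, d))%N ->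
           0 < eta <= 1 -> eta <= delta -> 0 < theta <= 1 -> theta <= delta ->
           gamma eta theta d n k <= eps)
    /\
    (* the main property *)
    (forall (d n : nat) (eta theta : R) (X : finType) (S : {set X})
            (mu : cfg X n d -> R),
        (0 < d)%N -> (4 * d <= n)%N ->
        0 < eta <= 1 -> 0 < theta <= 1 ->
        S != set0 ->
        is_distr mu ->
        spreadable eta mu ->
        box_independent theta S mu ->
        independent (gamma eta theta d n) S mu).
Proof.
(* Including 0 makes the set nonempty and its supremum nonnegative; the bound by 1 makes the
   supremum finite, uniformly in the alphabet. *)
pose deviation (eta theta : R) d n k : R -> Prop := fun r => r = 0 \/
  exists (X : finType) (S : {set X}) (mu : cfg X n d -> R) (F : {set dsub n d}) a,
  [/\ is_distr mu, spreadable eta mu, box_independent theta S mu & [/\ #|F| = k,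
    forall s, s \in F -> a s \in S &
    r = `| prob mu (fun c => [forall s in F, c s == a s])
           - \prod_(s in F) prob mu (fun c => c s == a s) |]].
have dev0 eta theta d n k : deviation eta theta d n k 0 by left.
have dev_le1 eta theta d n k r : deviation eta theta d n k r -> r <= 1.
  case=> [->|[X [S [mu [F [a [mu_distr _ _ [_ _ ->]]]]]]]]; first exact: ler01.
  have : 0 <= \prod_(s in F) prob mu (fun c => c s == a s) <= 1.
    apply/andP; split; first by apply: prodr_ge0 => s _; exact: prob_ge0.
    by apply: prodr_ile1 => s _; rewrite prob_ge0 ?prob_le1.
  have := prob_ge0 mu_distr (fun c => [forall s in F, c s == a s]).
  have := prob_le1 mu_distr (fun c => [forall s in F, c s == a s]).
  by rewrite ler_norml => ? ? /andP[? ?]; apply/andP; split; lra.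
have sup_ge eta theta d n k r : deviation eta theta d n k r ->
    r <= sup (deviation eta theta d n k).
  by move=> dr; apply: ub_le_sup dr; exists 1 => x; exact: dev_le1.
(* The summand [eta] makes the bound strictly positive and itself tends to zero. *)
exists (fun eta theta d n k => eta + sup (deviation eta theta d n k)); split; [|split].
- move=> eta theta d n k /andP[eta0 _] _ _ _ _.
  by rewrite ltr_pwDl // sup_ge.
- move=> d k d_gt0 k_gt0 eps eps0.
  have [|n0 [delta [delta0 H]]] := @box_independent_independent R d k (eps / 2) d_gt0 k_gt0.
    by rewrite divr_gt0.
  exists n0, (Num.min delta (eps / 2)); split; first by rewrite lt_min delta0 divr_gt0.
  move=> n eta theta n0n _ _ _.
  rewrite !le_min => /andP[eta_delta eta_eps] _ /andP[theta_delta _].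
  have : sup (deviation eta theta d n k) <= eps / 2; last by lra.
  apply: ge_sup; first by exists 0.
  move=> _ [->|[X [S [mu [F [a [mu_distr spr bx [Fk aS ->]]]]]]]].
    by rewrite divr_ge0 // ltW.
  apply: H aS => // [J K HJK dJ|H0 H0seq b bS].
    by apply: le_trans eta_delta; exact: spr.
  by apply: le_trans (bx H0 H0seq b bS) _; rewrite lerD2l.
- move=> d n eta theta X S mu _ _ /andP[eta0 _] _ _ mu_distr spr bx F _ _ a aS.
  apply: le_trans (_ : sup (deviation eta theta d n #|F|) <= _); last by rewrite lerDr ltW.
  by apply: sup_ge; right; exists X, S, mu, F, a.
Qed.
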